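(* Let $X=(X(t))_{t\in\mathbb{R}}$ be a two-sided self-similar process in $\mathbb{R}$ starting at $0$ of index $H>0$ such that $$-\log \mathbb{P}\Bigl(\sup_{0\le t\le 1} |X(t)|\le \epsilon \Bigr)\approx \epsilon^{-\tau} \quad\text{as } \epsilon\downarrow 0$$ for some $\tau>0$. Let $E=(E(t))_{t\ge 0}$ be a real-valued continuous process starting at $0$ (not necessarily nondecreasing, and possibly taking negative values), independent of $X$, such that $$\mathbb{P}\Bigl(\sup_{0\le t\le T}|E(t)|\le \epsilon\Bigr)\approx \epsilon^\sigma \quad\text{as } \epsilon\downarrow 0$$ for some $T>0$ and $\sigma>0$. Then $$\mathbb{P}\Bigl(\sup_{0\le t\le T} |X(E(t))|\le \epsilon \Bigr)\approx \epsilon^{\sigma/H} \quad\text{as } \epsilon\downarrow 0.$$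
   Context: For two positive functions $f,g$, the notation $f(\epsilon)\approx g(\epsilon)$ as $\epsilon\downarrow 0$ means $0<\liminf_{\epsilon\downarrow 0} f(\epsilon)/g(\epsilon)\le \limsup_{\epsilon\downarrow 0} f(\epsilon)/g(\epsilon)<\infty$. A stochastic process $(X(t))_{t\ge 0}$ in $\mathbb{R}$ is self-similar of index $H>0$ if for every $a>0$ the processes $(X(at))_{t\ge 0}$ and $(a^H X(t))_{t\ge 0}$ have the same distribution. A two-sided self-similar process of index $H$ starting at $0$ is obtained from a self-similar process $(X(t))_{t\ge 0}$ of index $H$ with $X(0)=0$ by taking an independent copy $X'=(X'(t))_{t\ge 0}$ of it and setting $X(t):=X'(-t)$ for $t<0$.
   Formalization: X is additionally assumed separable (automatic for one-sided continuous paths), since otherwise altering X at random times breaks the claim; the three suprema (of |X| on [0,1], of |E| and |X(E)| on [0,T]) are assumed measurable so that the probabilities make sense. *)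

(* Defs.v *)
(* MathComp-Analysis *)
From HB Require Import structures.
From mathcomp Require Import all_boot all_order all_algebra.
From mathcomp Require Import all_classical all_reals all_analysis.
From mathcomp Require Import measurable_realfun.

Set Implicit Arguments.
Unset Strict Implicit.
Unset Printing Implicit Defensive.

Import Order.TTheory GRing.Theory Num.Theory.
Import numFieldNormedType.Exports.

Local Open Scope classical_set_scope.
Local Open Scope ring_scope.

(* [f] may take infinite values, so that [- log P(A)] is meaningful when
   [P A = 0]; [liminf <= limsup] always holds and is not repeated. *)
Definition approx_at_right0 (R : realType) (f : R -> \bar R) (g : R -> R) :=
  (0 < limf_einf (fun e => f e * ((g e)^-1)%:E) 0^'+)%E /\
  (limf_esup (fun e => f e * ((g e)^-1)%:E) 0^'+ < +oo)%E.

(* A process indexed by a set [I] of times is a total family [X : R -> Omega ->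
   R] whose values outside of [I] are irrelevant. *)
Definition stochastic_process (d : measure_display) (Omega : measurableType d)
    (R : realType) (I : set R) (X : R -> Omega -> R) :=
  forall t, I t -> measurable_fun setT (X t).

(* The product sigma-algebra of [R^I], pulled back to paths [R -> R]. *)
Definition path_measurable (R : realType) (I : set R) : set_system (R -> R) :=
  <<s [set C | exists t (B : set R),
         [/\ I t, measurable B & C = [set x | B (x t)]] ] >>.

Definition same_law (d : measure_display) (Omega : measurableType d)
    (R : realType) (P : probability Omega R) (I : set R)
    (X Y : R -> Omega -> R) :=
  forall C, path_measurable I C ->
    P [set w | C (X ^~ w)] = P [set w | C (Y ^~ w)].

Definition independent_processes (d : measure_display)
    (Omega : measurableType d) (R : realType) (P : probability Omega R)
    (I J : set R) (X Y : R -> Omega -> R) :=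
  forall C D, path_measurable I C -> path_measurable J D ->
    P [set w | C (X ^~ w) /\ D (Y ^~ w)] =
    (P [set w | C (X ^~ w)] * P [set w | D (Y ^~ w)])%E.

Definition self_similar (d : measure_display) (Omega : measurableType d)
    (R : realType) (P : probability Omega R) (H : R) (X : R -> Omega -> R) :=
  forall a, 0 < a ->
    same_law P `[0, +oo[ (fun t => X (a * t)) (fun t w => a `^ H * X t w).

Definition starts_at0 (d : measure_display) (Omega : measurableType d)
    (R : realType) (P : probability Omega R) (X : R -> Omega -> R) :=
  {ae P, forall w, X 0 w = 0}.

Definition two_sided_self_similar (d : measure_display)
    (Omega : measurableType d) (R : realType) (P : probability Omega R)
    (H : R) (X : R -> Omega -> R) :=
  [/\ stochastic_process `[0, +oo[ X, self_similar P H X, starts_at0 P X &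
    exists X' : R -> Omega -> R,
      [/\ stochastic_process `[0, +oo[ X',
          same_law P `[0, +oo[ X' X,
          independent_processes P `[0, +oo[ `[0, +oo[ X' X &
          forall t, t < 0 -> X t = X' (- t)] ].

(* Doob's separability: almost every path is determined by its restriction to
   a fixed countable set of times, in the sense that its graph lies in the
   closure of the graph of the restriction.  Processes with one-sided
   continuous paths are separable.  Without it, suprema over uncountable sets of
   times are not determined by the law of the process, and may change under
   modification of the process. *)
Definition separable_process (d : measure_display) (Omega : measurableType d)
    (R : realType) (P : probability Omega R) (X : R -> Omega -> R) :=
  exists2 D : set R, countable D &
    {ae P, forall w, forall t,
       closure [set (s, X s w) | s in D] (t, X t w)}.

Definition continuous_process (d : measure_display) (Omega : measurableType d)
    (R : realType) (P : probability Omega R) (E : R -> Omega -> R) :=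
  stochastic_process `[0, +oo[ E /\
  {ae P, forall w, {within `[0, +oo[, continuous (E ^~ w)}}.

(* Extended-real valued: the real [sup] of an unbounded set is [0]. *)
Definition sup_abs (Omega : Type) (R : realType) (I : set R)
    (X : R -> Omega -> R) (w : Omega) : \bar R :=
  ereal_sup [set (`|X t w|)%:E | t in I].

Definition small_ball (d : measure_display) (Omega : measurableType d)
    (R : realType) (P : probability Omega R) (I : set R)
    (X : R -> Omega -> R) (e : R) : \bar R :=
  P [set w | (sup_abs I X w <= e%:E)%E].

(* Main.v *)
(* Write [S] for the supremum of [|E|] on [[0, T]], [phi x] for the probability
   that [|X| <= x] on [[0, 1]], and [a] for [e `^ H^-1].

   Lower bound: if [S <= r] and [|X| <= e] on [[- r, r]] then [|X o E| <= e].
   By independence of the two halves of [X] and of [E], and by self-similarity,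
   this has probability [P(S <= r) * phi (e / r `^ H) ^+ 2]; take for [r] the
   multiple of [a] for which [phi (e / r `^ H)] is a fixed positive number.

   Upper bound: if [S > r] then, by the intermediate value theorem, [E] covers
   [[0, r]] or [[- r, 0]], so that [|X o E| <= e] forces [|X| <= e] on one of
   them.  Cutting along the values [2 ^+ k * a] of [S] bounds the probability by
   [P(S <= a) + 2 \sum_k phi (2 `^ (- k * H)) * P(S <= 2 ^+ k.+1 * a)], in which
   the decay of [phi] makes the sum [O(a `^ sigma)].

   Independence and equality of laws apply to events determined by countably
   many times only, to which the suprema are reduced by separability of [X] and
   continuity of [E]. *)

Require Import Defs.
From HB Require Import structures.
From mathcomp Require Import all_boot all_order all_algebra.
From mathcomp Require Import all_classical all_reals all_analysis.
From mathcomp Require Import measurable_realfun.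
From mathcomp Require Import ring.

Set Implicit Arguments.
Unset Strict Implicit.
Unset Printing Implicit Defensive.

Import Order.TTheory GRing.Theory Num.Theory.
Import numFieldNormedType.Exports.

Local Open Scope classical_set_scope.
Local Open Scope ring_scope.

(** * Asymptotic equivalence as two-sided bounds near 0 *)

Lemma near_right0P (R : realType) (Q : R -> Prop) :
  (\forall e \near 0^'+, Q e) <->
  exists2 e0 : R, 0 < e0 & forall e, 0 < e < e0 -> Q e.
Proof.
split=> [[e0 /= e0_gt0 Qe]|[e0 e0_gt0 Qe]].
  exists e0 => // e /andP[e_gt0 ee0]; apply: Qe => //=.
  by rewrite sub0r normrN gtr0_norm.
exists e0 => //= e /=; rewrite sub0r normrN => ee0 e_gt0.
by apply: Qe; rewrite e_gt0 -(gtr0_norm e_gt0).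
Qed.

(** The lower limit is a supremum, over neighbourhoods, of infima: if it is positive, one
    neighbourhood already has a positive lower bound [c]. The upper limit is treated dually; no sign
    is claimed for [C]. *)
Lemma approx_at_right0P (R : realType) (f : R -> \bar R) (g : R -> R) :
    (forall e, 0 < e -> 0 < g e) ->
  approx_at_right0 f g <->
  exists c C e0 : R, [/\ 0 < c, 0 < e0 &
    forall e, 0 < e < e0 -> ((c * g e)%:E <= f e <= (C * g e)%:E)%E].
Proof.
move=> g_gt0; rewrite /approx_at_right0 limf_einfE limf_esupE; split.
  case=> /ereal_sup_gt[_ [V V0 <-]] infV_gt0.
  move=> /ereal_inf_lt[_ [W W0 <-]] supW_lt.
  have /near_right0P[e0 e0_gt0 VW] : \forall e \near 0^'+, V e /\ W e.
    exact: filterI.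
  have [c c_gt0 cV] : exists2 c : R, 0 < c &
      forall e, V e -> (c%:E <= f e * ((g e)^-1)%:E)%E.
    have [c [c_gt0 cV]] : exists c : R, 0 < c /\ (c%:E <= ereal_inf
        [set (f e * ((g e)^-1)%:E)%E | e in V])%E.
      move: infV_gt0; case: (ereal_inf _) => [c|_|//].
        by rewrite lte_fin => c_gt0; exists c.
      by exists 1; rewrite leey.
    exists c => // e Ve; apply: (le_trans cV).
    by apply: ereal_inf_lbound; exists e.
  have [C CW] : exists C : R,
      forall e, W e -> (f e * ((g e)^-1)%:E <= C%:E)%E.
    have [C CW] : exists C : R, (ereal_sup
        [set (f e * ((g e)^-1)%:E)%E | e in W] <= C%:E)%E.
      move: supW_lt; case: (ereal_sup _) => [C _|//|_]; first by exists C.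
      by exists 0; rewrite leNye.
    exists C => e We; apply: le_trans CW.
    by apply: ereal_sup_ubound; exists e.
  exists c, C, e0; split=> // e e_itv; have [Ve We] := VW e e_itv.
  have ge_gt0 : 0 < g e by apply: g_gt0; case/andP: e_itv.
  by rewrite !EFinM -lee_pdivrMr // CW // andbT -lee_pdivlMr // cV.
move=> [c [C [e0 [c_gt0 e0_gt0 bnd]]]].
have {}bnd e : 0 < e < e0 ->
    (c%:E <= f e * ((g e)^-1)%:E <= C%:E)%E.
  move=> e_itv; have /andP[cf fC] := bnd e e_itv.
  have ge_gt0 : 0 < g e by apply: g_gt0; case/andP: e_itv.
  by rewrite lee_pdivlMr // lee_pdivrMr // -!EFinM cf fC.
have V0 : \forall e \near (0:R)^'+, (0 < e < e0)%R.
  by apply/near_right0P; exists e0.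
split.
  apply: (@lt_le_trans _ _ c%:E); first by rewrite lte_fin.


  apply: le_ereal_sup_tmp.
  exists (ereal_inf [set (f e * ((g e)^-1)%:E)%E | e in [set e | 0 < e < e0]]).
    by exists [set e | 0 < e < e0].
  by apply: le_ereal_inf_tmp => _ [e /bnd /andP[? _] <-].
apply: (@le_lt_trans _ _ C%:E); last exact: ltry.
apply: ge_ereal_inf.
exists (ereal_sup [set (f e * ((g e)^-1)%:E)%E | e in [set e | 0 < e < e0]]).
  by exists [set e | 0 < e < e0].
by apply: ge_ereal_sup => _ [e /bnd /andP[_ ?] <-].
Qed.

(** * Measurability and comparison of small-ball events *)

Lemma countable_bigcap_measurable d (T : measurableType d) (U : Type)
    (I : set U) (F : U -> set T) :
  countable I -> (forall i, I i -> measurable (F i)) ->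
  measurable (\bigcap_(i in I) F i).
Proof.
move=> /pfcard_geP[->|[f]] mF; first by rewrite bigcap_set0.
rewrite -(image_eq f) bigcap_image; apply: bigcap_measurableType => n _.
by apply: mF; exact: funS.
Qed.

Section BallOn.
Context (R : realType).
Implicit Types (I J : set R) (e r : R).

(** A set of paths rather than an event, so that it can be fed to [same_law] and
    [independent_processes]. *)
Definition ball_on I e : set (R -> R) := [set x | forall t, I t -> `|x t| <= e].

Lemma ball_onE I e : ball_on I e = \bigcap_(t in I) [set x | x t \in `[- e, e]].
Proof.
apply/seteqP; split=> x xI t It; have := xI t It;
  by rewrite /= in_itv/= -ler_norml.
Qed.

Lemma path_measurable_ball_on I J e : countable I -> I `<=` J ->
  path_measurable J (ball_on I e).
Proof.
move=> I_count IJ; rewrite ball_onE.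
pose G : set_system (R -> R) := [set C | exists t (B : set R),
  [/\ J t, measurable B & C = [set x | B (x t)]] ].
apply: (@countable_bigcap_measurable _ (g_sigma_algebraType G)) => // t It.
apply: sub_sigma_algebra; exists t, [set` `[- e, e]]; split=> //; exact: IJ.
Qed.

Context d (Omega : measurableType d) (P : probability Omega R).
Implicit Types (X : R -> Omega -> R).

Lemma measurable_ball_on I J X e : countable I -> I `<=` J ->
  stochastic_process J X -> measurable [set w | ball_on I e (X ^~ w)].
Proof.
move=> I_count IJ X_meas.
have -> : [set w | ball_on I e (X ^~ w)] =
    \bigcap_(t in I) (setT `&` X t @^-1` `[- e, e]).
  rewrite ball_onE; apply/seteqP; split=> w Xw t It.
    by split=> //; exact: Xw.
  by have [] := Xw t It.
apply: countable_bigcap_measurable => // t It.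
by apply: X_meas => //; exact: IJ.
Qed.

Lemma sup_abs_leP I X (w : Omega) e :
  (sup_abs I X w <= e%:E)%E <-> ball_on I e (X ^~ w).
Proof.
split=> [Xe t It|Xe].
  rewrite -lee_fin; apply: le_trans Xe.
  by apply: ereal_sup_ubound; exists t.
by apply: ge_ereal_sup => _ [t It <-]; rewrite lee_fin; exact: Xe.
Qed.

(** For uncountable [I] no countable intersection is at hand; measurability is inherited from the
    supremum. *)
Lemma measurable_sup_abs_ball I X e :
  measurable_fun setT (sup_abs I X : Omega -> \bar R) ->
  measurable [set w | ball_on I e (X ^~ w)].
Proof.
move=> X_meas.
have -> : [set w | ball_on I e (X ^~ w)] =
    setT `&` [set w | (sup_abs I X w <= e%:E)%E].
  by rewrite setTI; apply/seteqP; split=> w /sup_abs_leP.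
exact: emeasurable_fun_infty_c.
Qed.

Lemma small_ballE I X e : small_ball P I X e = P [set w | ball_on I e (X ^~ w)].
Proof.
by congr (P _); apply/seteqP; split=> w /sup_abs_leP.
Qed.

Lemma ae_le_measure (A B : set Omega) : measurable A -> measurable B ->
  {ae P, forall w, A w -> B w} -> (P A <= P B)%E.
Proof.
move=> mA mB [N [mN PN0 AB]].
have sub : A `<=` B `|` N.
  move=> w Aw; have [|nBw] := pselect (B w); first by left.
  by right; apply: AB => /(_ Aw).
apply: (le_trans (le_measure P _ _ sub)); rewrite ?inE//.
  exact: measurableU.
by rewrite -[leRHS]adde0 -PN0; exact: measureU2.
Qed.

End BallOn.

(** * Reduction of path bounds to countably many times *)

Lemma countableU (T : Type) (A B : set T) :
  countable A -> countable B -> countable (A `|` B).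
Proof.
move=> A_count B_count.
have -> : A `|` B = \bigcup_(b in [set: bool]) (if b then A else B).
  apply/seteqP; split=> t; last by case=> -[] _; [left|right].
  by case=> ?; [exists true|exists false].
by apply: bigcup_countable => // -[].
Qed.

Lemma countable_image (T U : Type) (f : T -> U) (A : set T) :
  countable A -> countable (f @` A).
Proof. exact/sub_countable/card_image_le. Qed.

Section Paths.
Context (R : realType).
Implicit Types (D : set R) (x : R -> R) (a b e r T : R).

(** A violation at [t] is an open condition on the point [(t, x t)], the interval being open, so the
    graph over [D] contains a violation too. *)
Lemma ball_on_separable D x a b e :
  (forall t, closure [set (s, x s) | s in D] (t, x t)) ->
  ball_on (D `&` `]a, b[) e x -> ball_on `]a, b[ e x.
Proof.
move=> x_sep xD t t_ab; rewrite leNgt; apply/negP => ex.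
have [] := x_sep t ([set` `]a, b[] `*` [set y | e < `|y|]).
  exists ([set` `]a, b[], [set y : R | e < `|y|]) => //=.
  split; apply: open_nbhs_nbhs.
    by split => //; exact: interval_open.
  split=> //; apply: (@open_comp _ _ (fun y : R => `|y|) [set y | e < y]).
    by move=> y _; exact: norm_continuous.
  exact: open_gt.
move=> _ [[s Ds <-] [/= s_ab]]; apply/negP; rewrite -leNgt.
by apply: xD.
Qed.

(** A time [t < T] is approached by rationals from the right inside the interval; [T] itself is not,
    hence is added. *)
Definition rat_times T : set R :=
  [set t | t \in `[0, T] /\ (t = T \/ range ratr t)].

Lemma countable_rat_times T : countable (rat_times T).
Proof.
apply: (@sub_countable _ _ _ ([set T] `|` range ratr)).
  by apply: subset_card_le => t [_ []]; [left|right].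
apply: countableU; first exact: countable1.
exact/countable_image/countableP.
Qed.

Lemma rat_times_ge0 T : rat_times T `<=` `[0, +oo[.
Proof. by move=> t []; rewrite /= !in_itv/= => /andP[->]. Qed.

Lemma ball_on_continuous x T r : 0 < T ->
    {within `[0, +oo[, continuous x} ->
  ball_on (rat_times T) r x -> ball_on `[0, T] r x.
Proof.
move=> T_gt0 /subspace_continuousP x_cont xQ t; rewrite [X in X -> _]/= => t_0T.
have [->|tT] := eqVneq t T.
  by apply: xQ; split; [rewrite in_itv/= lexx ltW|left].
move: t_0T; rewrite in_itv/= => /andP[t_ge0].
rewrite le_eqVlt (negbTE tT)/= => {}tT.
rewrite leNgt; apply/negP => rx.
have /x_cont xt : [set` `[0, +oo[] t by rewrite /= in_itv/= t_ge0.
have /xt : nbhs (x t) [set y : R | r < `|y|].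
  apply: open_nbhs_nbhs; split=> //.
  apply: (@open_comp _ _ (fun y : R => `|y|) [set y | r < y]).
    by move=> y _; exact: norm_continuous.
  exact: open_gt.
move=> [/= e e_gt0 te].
have [q] : exists q : rat, ratr q \in `]t, (Num.min T (t + e))[.
  by apply: rat_in_itvoo; rewrite lt_min tT ltrDl.
rewrite in_itv/= lt_min => /and3P[tq qT qe].
have q_ge0 : 0 <= ratr q :> R by rewrite (le_trans t_ge0)// ltW.
have /= := te (ratr q); rewrite in_itv/= q_ge0 => /(_ _ isT).
rewrite ltr0_norm ?subr_lt0// opprB ltrBlDl => /(_ qe).
apply/negP; rewrite -leNgt; apply: xQ; split; last by right; exists q.
by rewrite in_itv/= q_ge0 ltW.
Qed.

(** If [|x t| > r], the path takes all values between [x 0 = 0] and [x t] before time [t]; the sign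
    of [x t] selects the half. *)
Lemma continuous_surj_half x T r : 0 < T -> 0 <= r -> x 0 = 0 ->
    {within `[0, +oo[, continuous x} -> ~ ball_on `[0, T] r x ->
  `[0, r] `<=` x @` `[0, T] \/ `[- r, 0] `<=` x @` `[0, T].
Proof.
move=> T_gt0 r_ge0 x0 x_cont /existsNP[t /not_implyP[/= t_0T]].
move: (t_0T); rewrite in_itv/= => /andP[t_ge0 tT].
move=> /negP; rewrite -ltNge => rx.
have x_cont_t : {within `[0, t], continuous x}.
  apply: continuous_subspaceW x_cont => s /=.
  by rewrite !in_itv/= => /andP[->].
have surj v : Num.min (x 0) (x t) <= v <= Num.max (x 0) (x t) ->
    (x @` `[0, T]) v.
  move=> /(IVT t_ge0 x_cont_t)[s]; rewrite in_itv/= => /andP[s_ge0 st] <-.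
  by exists s => //=; rewrite in_itv/= s_ge0 (le_trans st).
rewrite x0 in surj; case: (leP 0 (x t)) rx => [xt_ge0|xt_lt0].
  rewrite ger0_norm// => rx; left=> v; rewrite /= in_itv/= => /andP[v_ge0 vr].
  by apply: surj; rewrite min_l// max_r// v_ge0 (le_trans vr)// ltW.
rewrite ltr0_norm// => rx; right=> v; rewrite /= in_itv/= => /andP[rv v_le0].
have xt_le0 := ltW xt_lt0.
apply: surj; rewrite min_r ?max_l// v_le0 andbT (le_trans _ rv)//.
by rewrite lerNr ltW.
Qed.

End Paths.

(** * Small balls of [X] on rescaled and two-sided intervals *)

Section SmallBallScaling.
Context d (Omega : measurableType d) (R : realType) (P : probability Omega R).
Context (H : R) (X : R -> Omega -> R).
Hypothesis X_ss : two_sided_self_similar P H X.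
Hypothesis X_sep : separable_process P X.
Hypothesis supX_meas :
  measurable_fun setT (sup_abs `[0, 1] X : Omega -> \bar R).
Implicit Types (C : set R) (e r t : R).

Let phi e := small_ball P `[0, 1] X e.

(** Self-similarity with factor [r] turns times [r * t] into a factor r^H on the values, which is
    moved to the radius. *)
Lemma prob_ball_on_scale C e r : 0 < r -> countable C -> C `<=` `[0, +oo[ ->
  P [set w | ball_on [set r * t | t in C] e (X ^~ w)] =
  P [set w | ball_on C (e / r `^ H) (X ^~ w)].
Proof.
move=> r_gt0 C_count C_ge0; have [_ X_scale _ _] := X_ss.
have rH_gt0 : 0 < r `^ H by exact: powR_gt0.
have := X_scale r r_gt0 _ (path_measurable_ball_on e C_count C_ge0).
have -> : [set w | ball_on C e (fun t => X (r * t) w)] =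
    [set w | ball_on [set r * t | t in C] e (X ^~ w)].
  apply/seteqP; split=> w wC; first by move=> _ [t Ct <-]; exact: wC.
  by move=> t Ct; apply: wC; exists t.
move=> ->; congr (P _); apply/seteqP; split=> w wC t Ct; have := wC t Ct.
  by rewrite normrM gtr0_norm// ler_pdivlMr// mulrC.
by rewrite normrM gtr0_norm// ler_pdivlMr// mulrC.
Qed.

(** Shrinking [C] by [r] puts it inside [0, 1], where a bound on all times implies one on the shrunk
    set. *)
Lemma small_ball_le_prob C e r : 0 < r -> countable C -> C `<=` `[0, r] ->
  (phi (e / r `^ H) <= P [set w | ball_on C e (X ^~ w)])%E.
Proof.
move=> r_gt0 C_count C_r; have [X_meas _ _ _] := X_ss.
pose C1 : set R := [set r^-1 * t | t in C].
have C1_count : countable C1 by exact: countable_image.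
have C1_01 : C1 `<=` `[0, 1].
  move=> _ [t /C_r + <-]; rewrite /= !in_itv/= => /andP[t_ge0 tr].
  by rewrite mulr_ge0 ?invr_ge0 ?(ltW r_gt0)//= mulrC ler_pdivrMr// mul1r.
have C1_ge0 : C1 `<=` `[0, +oo[.
  by move=> t /C1_01; rewrite /= !in_itv/= => /andP[->].
have -> : C = [set r * t | t in C1].
  rewrite image_comp -[LHS]image_id; apply: eq_imagel => t _ /=.
  by rewrite mulrA divff ?mul1r// gt_eqF.
rewrite prob_ball_on_scale// /phi small_ballE; apply: le_measure.
- by rewrite inE; exact: measurable_sup_abs_ball.
- by rewrite inE; exact: measurable_ball_on X_meas.
- by move=> w wX t /C1_01; exact: wX.
Qed.

(* Separability alone controls only the open interval: at [0] the path vanishes,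
   and the time [r] is added to the countable set. *)
Lemma exists_prob_le_small_ball r : 0 < r -> exists C : set R,
  [/\ countable C, C `<=` `]0, r] &
    forall e, 0 <= e ->
      (P [set w | ball_on C e (X ^~ w)] <= phi (e / r `^ H))%E].
Proof.
move=> r_gt0; have [X_meas _ X0 _] := X_ss; have [D D_count XD] := X_sep.
pose C1 : set R := (D `&` [set` `]0, 1[]) `|` [set 1].
have C1_count : countable C1.
  apply: countableU; last exact: countable1.
  by apply: sub_countable D_count; apply: subset_card_le => t [].
have C1_01 : C1 `<=` `]0, 1].
  move=> t [[_]|->]; rewrite /= !in_itv/= ?lexx ?ltr01// => /andP[-> /ltW ->//].
have C1_ge0 : C1 `<=` `[0, +oo[.
  by move=> t /C1_01; rewrite /= !in_itv/= => /andP[/ltW ->].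
exists [set r * t | t in C1]; split; first exact: countable_image.
  move=> _ [t /C1_01 + <-]; rewrite /= !in_itv/= => /andP[t_gt0 t1].
  by rewrite mulr_gt0//= ger_pMr.
move=> e e_ge0; rewrite prob_ball_on_scale// /phi small_ballE.
apply: ae_le_measure.
- exact: measurable_ball_on X_meas.
- exact: measurable_sup_abs_ball.
apply: filterS2 X0 XD => w X0w XDw wC t.
have eH_ge0 : 0 <= e / r `^ H by rewrite divr_ge0// powR_ge0.
rewrite /= in_itv/= => /andP[]; rewrite le_eqVlt => /predU1P[<- _|t_gt0].
  by rewrite X0w normr0.
rewrite le_eqVlt => /predU1P[->|t_lt1]; first by apply: wC; right.
apply: (ball_on_separable (a := 0) (b := 1) XDw).
  2: by rewrite /= in_itv/= t_gt0.
by move=> s Ds; apply: wC; left.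
Qed.

(** At negative times [X] is the reflection of [X'], which has the law of [X]. The time 0 is kept
    out of [C] because [X'] describes [X] at strictly negative times only. *)
Lemma prob_ball_on_opp C e : countable C -> C `<=` `]0, +oo[ ->
  P [set w | ball_on (-%R @` C) e (X ^~ w)] = P [set w | ball_on C e (X ^~ w)].
Proof.
move=> C_count C_gt0; have [_ _ _ [X' [_ X'_law _ X_neg]]] := X_ss.
have C_ge0 : C `<=` `[0, +oo[.
  by move=> t /C_gt0; rewrite /= !in_itv/= => /andP[/ltW ->].
rewrite -(X'_law _ (path_measurable_ball_on e C_count C_ge0)).
congr (P _); apply/seteqP; split=> w wC.
  move=> t Ct; have := C_gt0 _ Ct; rewrite /= in_itv/= andbT => t_gt0.
  have := wC (- t); rewrite X_neg ?oppr_lt0// opprK; apply.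
  by exists t.
move=> _ [t Ct <-]; have := C_gt0 _ Ct; rewrite /= in_itv/= andbT => t_gt0.
by rewrite X_neg ?oppr_lt0// opprK; exact: wC.
Qed.

Lemma prob_ball_on_indep C e : countable C -> C `<=` `]0, +oo[ ->
  P [set w | ball_on (C `|` -%R @` C) e (X ^~ w)] =
  (P [set w | ball_on C e (X ^~ w)] * P [set w | ball_on C e (X ^~ w)])%E.
Proof.
move=> C_count C_gt0; have [_ _ _ [X' [_ X'_law X'_ind X_neg]]] := X_ss.
have C_ge0 : C `<=` `[0, +oo[.
  by move=> t /C_gt0; rewrite /= !in_itv/= => /andP[/ltW ->].
have mC := path_measurable_ball_on e C_count C_ge0.
rewrite -[X in (X * _)%E]X'_law// -X'_ind//.
congr (P _); apply/seteqP; split=> w.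
  move=> wC; split=> t Ct; last by apply: wC; left.
  have := C_gt0 _ Ct; rewrite /= in_itv/= andbT => t_gt0.
  have := wC (- t); rewrite X_neg ?oppr_lt0// opprK; apply.
  by right; exists t.
move=> [wC' wC] t [/wC//|[s Cs <-]].
have := C_gt0 _ Cs; rewrite /= in_itv/= andbT => s_gt0.
by rewrite X_neg ?oppr_lt0// opprK; exact: wC'.
Qed.

Lemma exists_small_ball_square_le r e : 0 < r -> 0 <= e -> exists C : set R,
  [/\ countable C,
      (phi (e / r `^ H) * phi (e / r `^ H) <=
        P [set w | ball_on C e (X ^~ w)])%E &
      {ae P, forall w, ball_on C e (X ^~ w) -> ball_on `[- r, r] e (X ^~ w)}].
Proof.
move=> r_gt0 e_ge0; have [_ _ X0 _] := X_ss; have [D D_count XD] := X_sep.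
(* Symmetrizing [D] lets the positive set [C] and its reflection cover every nonzero time of [D] in
   the open interval; [r] is added for the endpoints. *)
pose C : set R := ((D `|` -%R @` D) `&` [set` `]0, r[]) `|` [set r].
have C_count : countable C.
  apply: countableU; last exact: countable1.
  apply: (@sub_countable _ _ _ (D `|` -%R @` D)).
    by apply: subset_card_le => t [].
  by apply: countableU => //; exact: countable_image.
have C_r : C `<=` `]0, r].
  move=> t [[_]|->]; rewrite /= !in_itv/= ?lexx ?andbT//.
  by move=> /andP[-> /ltW ->].
exists (C `|` -%R @` C); split.
- by apply: countableU => //; exact: countable_image.
- rewrite prob_ball_on_indep//; last first.
    by move=> t /C_r; rewrite /= !in_itv/= => /andP[->].
  have phi_le : (phi (e / r `^ H) <= P [set w | ball_on C e (X ^~ w)])%E.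
    apply: small_ball_le_prob => // t /C_r.
    by rewrite /= !in_itv/= => /andP[/ltW -> ->].
  by apply: lee_pmul => //; exact: measure_ge0.
apply: filterS2 X0 XD => w X0w XDw wC t.
rewrite /= in_itv/= => /andP[]; rewrite le_eqVlt => /predU1P[<- _|rt].
  by apply: wC; right; exists r => //; right.
rewrite le_eqVlt => /predU1P[->|tr]; first by apply: wC; left; right.
apply: (ball_on_separable (a := - r) (b := r) XDw).
  2: by rewrite /= in_itv/= rt tr.
move=> s [Ds]; rewrite /= in_itv/= => /andP[rs sr].
have [s_gt0|s_lt0|<-] := ltgtP 0 s; last by rewrite X0w normr0.
  by apply: wC; left; left; split; [left|rewrite /= in_itv/= s_gt0].
apply: wC; right; exists (- s); last by rewrite opprK.
left; split; first by right; exists s.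
by rewrite /= in_itv/= oppr_gt0 s_lt0 ltrNl.
Qed.

End SmallBallScaling.

(** * Power bounds and the dyadic recursion *)

Section Decay.
Context (R : realType).
Implicit Types (c e q tau : R).

(** With y = c e^(-tau), raise exp(u) >= u at u = y tau / q to the power q / tau; the right-hand
    side is the inverse of u^(q / tau). *)
Lemma expR_powR_decay c e q tau : 0 < c -> 0 < e -> 0 < q -> 0 < tau ->
  expR (- (c * e `^ (- tau))) <= (c * tau / q) `^ (- (q / tau)) * e `^ q.
Proof.
move=> c_gt0 e_gt0 q_gt0 tau_gt0; set y := c * _.
have y_gt0 : 0 < y by rewrite mulr_gt0// powR_gt0.
have -> : (c * tau / q) `^ (- (q / tau)) * e `^ q =
    ((y * tau / q) `^ (q / tau))^-1.
  have -> : y * tau / q = c * tau / q * e `^ (- tau) by rewrite /y; ring.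
  have : 0 <= c * tau / q by rewrite ltW// divr_gt0// mulr_gt0.
  move: (c * tau / q) => b b_ge0; rewrite [in RHS]powRM ?powR_ge0//.
  rewrite -[in RHS]powRrM mulNr mulrCA divff ?mulr1 ?gt_eqF//.
  by rewrite invfM !powRN invrK.
rewrite expRN lef_pV2 ?posrE ?expR_gt0 ?powR_gt0 ?divr_gt0 ?mulr_gt0//;
  last exact: powR_gt0.
rewrite -[X in expR X](_ : y * tau / q * (q / tau) = y); last first.
  by field; rewrite !gt_eqF.
rewrite expRM ge0_ler_powR ?nnegrE ?expR_ge0//.
- by rewrite ltW// divr_gt0.
- by rewrite ltW// divr_gt0// mulr_gt0.
- by rewrite (le_trans _ (expR_ge1Dx _))// lerDr.
Qed.

Lemma le_expR_of_lne (p : \bar R) y :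
  (0 <= p <= 1)%E -> (y%:E <= - lne p)%E -> (p <= (expR (- y))%:E)%E.
Proof.
case: p => [p| |]; rewrite ?leye_eq ?andbF// lee_fin => /andP[].
rewrite le_eqVlt => /predU1P[<- _ _|p_gt0 _]; first by rewrite lee_fin expR_ge0.
rewrite lne_EFin// -EFinN !lee_fin => y_le.
by rewrite -[leLHS]lnK ?posrE// ler_expR lerNr.
Qed.

(** Beyond [e0] the bound 1 <= (e / e0)^q suffices, whence the added constant; the absolute value
    covers a negative [C]. *)
Lemma extend_powR_bound (f : R -> \bar R) C q e0 : 0 < q -> 0 < e0 ->
    (forall e, (f e <= 1)%E) ->
    (forall e, 0 < e < e0 -> (f e <= (C * e `^ q)%:E)%E) ->
  exists2 C' : R, 0 < C' & forall e, 0 < e -> (f e <= (C' * e `^ q)%:E)%E.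
Proof.
move=> q_gt0 e0_gt0 f_le1 fC.
have e0q_gt0 : 0 < (e0 `^ q)^-1 by rewrite invr_gt0 powR_gt0.
exists (`|C| + (e0 `^ q)^-1) => [|e e_gt0]; first exact: ltr_wpDl.
have eq_ge0 : 0 <= e `^ q by exact: powR_ge0.
have [ee0|e0e] := ltP e e0.
  apply: le_trans (fC e _) _; first by rewrite e_gt0.
  rewrite lee_fin ler_wpM2r// (le_trans (ler_norm _))// lerDl ltW//.
apply: le_trans (f_le1 e) _; rewrite lee_fin mulrDl.
apply: (@le_trans _ _ ((e0 `^ q)^-1 * e `^ q)); last by rewrite lerDr mulr_ge0.
rewrite mulrC ler_pdivlMr ?powR_gt0// mul1r.
by apply: ge0_ler_powR; rewrite ?nnegrE// ltW.
Qed.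

(* [m r] stands for [P(S <= r, |X o E| <= a `^ H)] and [p r] for [P(S <= r)].
   The exponent [(sigma + 1) / H] makes the k-th increment proportional to
   [2 ^- k]. *)
Lemma dyadic_bound (m p phi : R -> \bar R) (H sigma C1 C2 a : R) :
    0 < H -> 0 < a -> 0 < C1 -> 0 < C2 ->
    (forall x, (0 <= phi x)%E) -> (forall r, (0 <= p r)%E) ->
    (forall r r', 0 < r ->
      (m r' <= m r + 2%:E * (phi (a `^ H / r `^ H)%R * p r'))%E) ->
    (m a <= p a)%E ->
    (forall r, 0 < r -> (p r <= (C2 * r `^ sigma)%:E)%E) ->
    (forall x, 0 < x -> (phi x <= (C1 * x `^ ((sigma + 1) / H))%:E)%E) ->
  forall k, (m (2 ^+ k * a)%R <=
    ((C2 + C1 * C2 * 2 `^ sigma * (4 - 4 / 2 ^+ k)) * a `^ sigma)%:E)%E.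
Proof.
move=> H_gt0 a_gt0 C1_gt0 C2_gt0 phi_ge0 p_ge0 m_step ma p_le phi_le.
elim=> [|k IHk].
  by rewrite expr0 mul1r divr1 subrr mulr0 addr0 (le_trans ma)// p_le.
have r_gt0 : 0 < 2 ^+ k * a by rewrite mulr_gt0// exprn_gt0.
have r'_gt0 : 0 < 2 ^+ k.+1 * a by rewrite mulr_gt0// exprn_gt0.
have tk_gt0 : (0:R) < 2 ^+ k by rewrite exprn_gt0.
(* The factor 2^(-k sigma) obtained here cancels the growth of [p] at 2^(k+1) a and leaves
   2^(-k). *)
have phi_k : (phi (a `^ H / (2 ^+ k * a) `^ H)%R <=
    (C1 * ((2 ^+ k) `^ sigma)^-1 / 2 ^+ k)%:E)%E.
  apply: le_trans (phi_le _ _) _; first by rewrite divr_gt0 ?powR_gt0.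
  have -> : a `^ H / (2 ^+ k * a) `^ H = (2 ^+ k) `^ (- H).
    rewrite powRM ?ltW// invfM mulrCA divff ?mulr1 ?powRN//.
    by rewrite gt_eqF ?powR_gt0.
  rewrite -powRrM mulNr mulrCA divff ?gt_eqF// mulr1 powRN powRD; last first.
    by rewrite (gt_eqF tk_gt0) implybT.
  by rewrite invfM powRr1 ?(ltW tk_gt0)// lee_fin mulrA.
have p_k : (p (2 ^+ k.+1 * a)%R <=
    (C2 * (2 `^ sigma * (2 ^+ k) `^ sigma * a `^ sigma))%:E)%E.
  apply: le_trans (p_le _ r'_gt0) _.
  by rewrite lee_fin exprS !powRM ?mulr_ge0 ?(ltW a_gt0) ?(ltW tk_gt0).
apply: le_trans (m_step _ _ r_gt0) _.
apply: (@le_trans _ _ (((C2 + C1 * C2 * 2 `^ sigma * (4 - 4 / 2 ^+ k)) *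
    a `^ sigma)%:E + 2%:E * ((C1 * ((2 ^+ k) `^ sigma)^-1 / 2 ^+ k)%:E *
   (C2 * (2 `^ sigma * (2 ^+ k) `^ sigma * a `^ sigma))%:E))%E).
  apply: leeD => //; rewrite lee_pmul2l//.
  exact: lee_pmul.
(* An equality: the increment carries 2 / 2^k = 4 / 2^k - 4 / 2^(k+1). *)
rewrite -!EFinM -EFinD lee_fin exprS.
have ts_neq0 : (2 ^+ k) `^ sigma != 0 by rewrite gt_eqF ?powR_gt0.
have tk_neq0 : (2 ^+ k) != 0 :> R by rewrite gt_eqF.
rewrite le_eqVlt; apply/orP; left; apply/eqP; field.
exact/andP.
Qed.

End Decay.

(** * Bounds for the time-changed process *)

Section TimeChange.
Context d (Omega : measurableType d) (R : realType) (P : probability Omega R).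
Context (H T : R) (X E : R -> Omega -> R).
Hypothesis T_gt0 : 0 < T.
Hypothesis X_ss : two_sided_self_similar P H X.
Hypothesis X_sep : separable_process P X.
Hypothesis E_cont : continuous_process P E.
Hypothesis E_start : starts_at0 P E.
Hypothesis XE_indep : independent_processes P setT `[0, +oo[ X E.
Hypothesis X_meas : stochastic_process setT X.
Hypothesis supX_meas :
  measurable_fun setT (sup_abs `[0, 1] X : Omega -> \bar R).
Hypothesis supE_meas :
  measurable_fun setT (sup_abs `[0, T] E : Omega -> \bar R).
Let Y t w := X (E t w) w.
Hypothesis supY_meas :
  measurable_fun setT (sup_abs `[0, T] Y : Omega -> \bar R).

Let phi e := small_ball P `[0, 1] X e.
(** Stated over countably many times, so that independence from [X] applies; by continuity its
    probability is that of the full interval. *)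
Let E_small r := [set w | ball_on (rat_times T) r (E ^~ w)].
Let Y_small e := [set w | ball_on `[0, T] e (Y ^~ w)].

Lemma measurable_E_small r : measurable (E_small r).
Proof.
have [E_meas _] := E_cont.
exact: measurable_ball_on (countable_rat_times T) (@rat_times_ge0 _ T) E_meas.
Qed.

Lemma prob_E_smallE r : P (E_small r) = small_ball P `[0, T] E r.
Proof.
rewrite small_ballE; apply/eqP; rewrite eq_le; apply/andP; split.
  apply: ae_le_measure; first exact: measurable_E_small.
    exact: measurable_sup_abs_ball.
  by have [_] := E_cont; apply: filterS => w Ew; exact: ball_on_continuous.
apply: le_measure; rewrite ?inE; first exact: measurable_sup_abs_ball.
  exact: measurable_E_small.
by move=> w Ew t [/Ew].
Qed.

Lemma prob_small_time_change_ge e r : 0 < r -> 0 <= e ->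
  (phi (e / r `^ H)%R * phi (e / r `^ H)%R * P (E_small r) <= P (Y_small e))%E.
Proof.
move=> r_gt0 e_ge0.
have [C [C_count phi_le XC]] :=
  exists_small_ball_square_le X_ss X_sep supX_meas r_gt0 e_ge0.
have mXC : measurable [set w | ball_on C e (X ^~ w)].
  exact: measurable_ball_on X_meas.
apply: (@le_trans _ _ (P ([set w | ball_on C e (X ^~ w)] `&` E_small r))).
  have := XE_indep (path_measurable_ball_on e C_count (@subsetT _ C))
    (path_measurable_ball_on r (countable_rat_times T) (@rat_times_ge0 _ T)).
  move=> ->; apply: lee_pmul => //; first by rewrite mule_ge0 ?measure_ge0.
apply: ae_le_measure; first exact: measurableI (measurable_E_small r).
  exact: measurable_sup_abs_ball.
have [_ E_path] := E_cont.
apply: filterS2 XC E_path => w XCw Ew [wC wE] t tT.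
have /XCw := wC; apply.
rewrite /= in_itv/= -ler_norml.
exact: (ball_on_continuous T_gt0 Ew wE).
Qed.

(** The event [D] on [E] is carried along for two uses: a bound on [E] at the next dyadic level, and
    [setT] for the tail. *)
Lemma prob_small_time_change_le D e r : 0 < r -> 0 <= e ->
    path_measurable `[0, +oo[ D -> measurable [set w | D (E ^~ w)] ->
  (P (Y_small e `&` [set w | D (E ^~ w)]) <= P (Y_small e `&` E_small r) +
    2%:E * (phi (e / r `^ H)%R * P [set w | D (E ^~ w)]))%E.
Proof.
move=> r_gt0 e_ge0 pD mD; set F := [set w | _].
have [C [C_count C_r phi_ge]] :=
  exists_prob_le_small_ball X_ss X_sep supX_meas r_gt0.
have {}phi_ge := phi_ge e e_ge0.
have C_gt0 : C `<=` `]0, +oo[.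
  by move=> t /C_r; rewrite /= !in_itv/= => /andP[->].
have C'_count : countable (-%R @` C) by exact: countable_image.
(* [A] and [A'] correspond to [E] covering the positive and the negative half. *)
pose A := [set w | ball_on C e (X ^~ w)] `&` F.
pose A' := [set w | ball_on (-%R @` C) e (X ^~ w)] `&` F.
have mA : measurable A.
  by apply: measurableI => //; exact: measurable_ball_on X_meas.
have mA' : measurable A'.
  by apply: measurableI => //; exact: measurable_ball_on X_meas.
have PA : (P A <= phi (e / r `^ H)%R * P F)%E.
  have := XE_indep (path_measurable_ball_on e C_count (@subsetT _ C)) pD.
  by rewrite /A => ->; apply: lee_pmul.
have PA' : (P A' <= phi (e / r `^ H)%R * P F)%E.
  have := XE_indep (path_measurable_ball_on e C'_count (@subsetT _ _)) pD.
  by rewrite /A' => ->; apply: lee_pmul => //; rewrite (prob_ball_on_opp X_ss).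
have mY : measurable (Y_small e) by exact: measurable_sup_abs_ball.
have mYE : measurable (Y_small e `&` E_small r).
  exact: measurableI (measurable_E_small r).
apply: (@le_trans _ _ (P ((Y_small e `&` E_small r) `|` (A `|` A')))).
  apply: ae_le_measure; first exact: measurableI.
    by apply: measurableU => //; exact: measurableU.
  have [_ E_path] := E_cont.
  apply: filterS2 E_start E_path => w E0 Ew [Yw Fw].
  have [wE|wE] := pselect (ball_on `[0, T] r (E ^~ w)).
    by left; split=> // t [/wE].
  have Xv v : (E ^~ w @` `[0, T]) v -> `|X v w| <= e.
    by move=> [t tT <-]; exact: Yw.
  right; have [sub|sub] := continuous_surj_half T_gt0 (ltW r_gt0) E0 Ew wE.
    left; split=> // t /C_r tC; apply/Xv/sub.
    by move: tC; rewrite /= !in_itv/= => /andP[/ltW -> ->].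
  right; split=> // _ [t /C_r tC <-]; apply/Xv/sub.
  by move: tC; rewrite /= !in_itv/= oppr_le0 lerN2 => /andP[/ltW -> ->].
apply: le_trans (measureU2 P _ _) _ => //; first exact: measurableU.
apply: leeD => //; apply: le_trans (measureU2 P _ _) _ => //.
by rewrite mule_natl mule2n; exact: leeD.
Qed.

End TimeChange.

(** * Choice of constants and proof of the equivalence *)

Lemma two_sided_stochastic_process d (Omega : measurableType d) (R : realType)
    (P : probability Omega R) (H : R) (X : R -> Omega -> R) :
  two_sided_self_similar P H X -> stochastic_process setT X.
Proof.
move=> [X_meas _ _ [X' [X'_meas _ _ X_neg]]] t _.
have [t_ge0|t_lt0] := leP 0 t.
  by apply: X_meas; rewrite /= in_itv/= t_ge0.
by rewrite X_neg//; apply: X'_meas; rewrite /= in_itv/= oppr_ge0 ltW.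
Qed.

Theorem theorem11 (d : measure_display) (Omega : measurableType d)
    (R : realType) (P : probability Omega R) (H tau sigma T : R)
    (X E : R -> Omega -> R)
    (H_gt0 : 0 < H) (tau_gt0 : 0 < tau) (sigma_gt0 : 0 < sigma) (T_gt0 : 0 < T)
    (X_ss : two_sided_self_similar P H X)
    (X_sep : separable_process P X)
    (E_cont : continuous_process P E)
    (E_start : starts_at0 P E)
    (XE_indep : independent_processes P setT `[0, +oo[ X E)
    (supX_meas : measurable_fun setT (sup_abs `[0, 1] X : Omega -> \bar R))
    (supE_meas : measurable_fun setT (sup_abs `[0, T] E : Omega -> \bar R))
    (supXE_meas : measurable_fun setT
       (sup_abs `[0, T] (fun t w => X (E t w) w) : Omega -> \bar R))
    (X_small : approx_at_right0
       (fun e => (- lne (small_ball P `[0%R, 1%R] X e))%E)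
       (fun e => e `^ (- tau)))
    (E_small : approx_at_right0
       (small_ball P `[0, T] E) (fun e => e `^ sigma)) :
  approx_at_right0
    (small_ball P `[0, T] (fun t w => X (E t w) w))
    (fun e => e `^ (sigma / H)).
Proof.
have X_meas := two_sided_stochastic_process X_ss.
have powR_pos q e : 0 < e -> 0 < e `^ q :> R by exact: powR_gt0.
have [c [CX [eX [c_gt0 eX_gt0 X_bnd]]]] :=
  (approx_at_right0P _ (powR_pos (- tau))).1 X_small.
have [cE [CE [eE [cE_gt0 eE_gt0 E_bnd]]]] :=
  (approx_at_right0P _ (powR_pos sigma)).1 E_small.
pose phi e := small_ball P `[0, 1] X e.
pose p r := P [set w | ball_on (rat_times T) r (E ^~ w)].
pose Y t w := X (E t w) w.
have pE r : p r = small_ball P `[0, T] E r.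
  by rewrite /p (prob_E_smallE T_gt0 E_cont supE_meas).
have phi_01 e : (0 <= phi e <= 1)%E.
  rewrite /phi small_ballE measure_ge0 probability_le1//.
  exact: measurable_sup_abs_ball.
have phi_ge0 e : (0 <= phi e)%E by case/andP: (phi_01 e).
have p_le1 r : (p r <= 1)%E.
  by apply: probability_le1; exact: (measurable_E_small T E_cont).
apply/(approx_at_right0P _ (powR_pos _)).
(* If [phi] vanished at [eX / 2], the negated logarithm would be infinite there, against the finite
   upper bound in [X_bnd]. *)
have [x0 [x0_gt0 phi_x0]] : exists x0, 0 < x0 /\ (0 < phi x0)%E.
  exists (eX / 2); split; first by rewrite divr_gt0.
  rewrite ltNge; apply/negP => phi_le0.
  have /X_bnd/andP[_] : 0 < eX / 2 < eX.
    by rewrite divr_gt0//= ltr_pdivrMr// ltr_pMr// ltr1n.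
  by rewrite -/(phi _) le0_lneNy.
have phi_x0_fin : phi x0 = (fine (phi x0))%:E.
  have /andP[_ phi_le1] := phi_01 x0.
  by rewrite fineK// ge0_fin_numE ?ltW// (le_lt_trans phi_le1) ?ltry.
set f := fine (phi x0) in phi_x0_fin.
have f_gt0 : 0 < f by rewrite -lte_fin -phi_x0_fin.
have lower e : 0 < e -> e < x0 * eE `^ H ->
    ((f * f * cE * x0 `^ (- (sigma / H)) * e `^ (sigma / H))%:E <=
    small_ball P `[0%R, T] Y e)%E.
  (* This [r] solves e / r^H = x0, and the threshold on [e] amounts to [r < eE]. *)
  move=> e_gt0 e_lt; pose r := (e / x0) `^ H^-1.
  have ex0_gt0 : 0 < e / x0 by rewrite divr_gt0.
  have r_gt0 : 0 < r by exact: powR_gt0.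
  have rHE : r `^ H = e / x0.
    by rewrite /r -powRrM mulVf ?gt_eqF// powRr1 ?ltW.
  have r_lt : r < eE.
    rewrite ltNge; apply/negP => eEr.
    have : eE `^ H <= r `^ H by apply: ge0_ler_powR; rewrite ?nnegrE// ltW.
    by rewrite rHE leNgt ltr_pdivrMr// mulrC e_lt.
  have /andP[+ _] : (((cE * r `^ sigma)%:E <= small_ball P `[0%R, T] E r <=
      (CE * r `^ sigma)%:E)%E) by apply: E_bnd; rewrite r_gt0.
  rewrite -pE => p_ge; rewrite small_ballE.
  have := prob_small_time_change_ge T_gt0 X_ss X_sep E_cont XE_indep X_meas
    supX_meas supXE_meas r_gt0 (ltW e_gt0).
  rewrite rHE invf_div mulrCA divff ?gt_eqF// mulr1.
  rewrite -/(phi x0) phi_x0_fin; apply: le_trans.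
  rewrite -EFinM; apply: le_trans (lee_pmul _ _ (lexx _) p_ge).
  - rewrite -EFinM lee_fin le_eqVlt; apply/orP; left; apply/eqP.
    rewrite /r -powRrM (mulrC _ sigma) powRM ?ltW ?invr_gt0//.
    by rewrite -[x0^-1]powR_inv1 ?ltW// -powRrM mulN1r; ring.
  - by rewrite lee_fin ltW// mulr_gt0.
  - by rewrite lee_fin ltW// mulr_gt0// powR_gt0.
(* Bounds for all positive arguments are required, since the dyadic levels 2^k a are unbounded. *)
have [C2 C2_gt0 p_le] : exists2 C2 : R, 0 < C2 &
    forall r, 0 < r -> (p r <= (C2 * r `^ sigma)%:E)%E.
  apply: (extend_powR_bound sigma_gt0 eE_gt0 p_le1 (C := CE)) => e /E_bnd.
  by rewrite -pE => /andP[].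
have q_gt0 : 0 < (sigma + 1) / H by rewrite divr_gt0// addr_gt0.
have [C1 C1_gt0 phi_le] : exists2 C1 : R, 0 < C1 &
    forall x, 0 < x -> (phi x <= (C1 * x `^ ((sigma + 1) / H))%:E)%E.
  apply: (extend_powR_bound q_gt0 eX_gt0
    (C := (c * tau / ((sigma + 1) / H)) `^ (- ((sigma + 1) / H / tau)))).
    by move=> e; case/andP: (phi_01 e).
  move=> e e_itv; have e_gt0 : 0 < e by case/andP: e_itv.
  have /andP[phi_lne _] := X_bnd e e_itv.
  apply: le_trans (le_expR_of_lne (phi_01 e) phi_lne) _.
  by rewrite lee_fin expR_powR_decay.
(* The dyadic sums stay below their limit, with factor 4; the final 1 absorbs the tail. *)
pose M := C2 + C1 * C2 * 2 `^ sigma * 4 + 1.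
have upper e : 0 < e ->
    (small_ball P `[0%R, T] Y e <= (M * e `^ (sigma / H))%:E)%E.
  move=> e_gt0; pose a := e `^ H^-1.
  have a_gt0 : 0 < a by exact: powR_gt0.
  have aHE : a `^ H = e by rewrite /a -powRrM mulVf ?gt_eqF// powRr1 ?ltW.
  have aE : a `^ sigma = e `^ (sigma / H) by rewrite /a -powRrM mulrC.
  pose A := [set w | ball_on `[0, T] e (Y ^~ w)].
  pose m r := P (A `&` [set w | ball_on (rat_times T) r (E ^~ w)]).
  have mE := measurable_E_small T E_cont.
  have mA : measurable A by exact: measurable_sup_abs_ball.
  have step D r := prob_small_time_change_le T_gt0 X_ss X_sep E_cont E_start
    XE_indep X_meas supX_meas supXE_meas (D := D) (e := e) (r := r).
  have m_bnd k : (m (2 ^+ k * a)%R <=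
      ((C2 + C1 * C2 * 2 `^ sigma * (4 - 4 / 2 ^+ k)) * a `^ sigma)%:E)%E.
    apply: (dyadic_bound (p := p) (phi := phi) (H := H)) => //.
    - move=> r r' r_gt0; rewrite aHE; apply: step => //; first exact: ltW.
      exact: path_measurable_ball_on (countable_rat_times T)
         (@rat_times_ge0 _ T).
    - apply: le_measure; rewrite ?inE//; first exact: measurableI.
  (* The tail, where [E] exceeds 2^k a: phi(2^(-k H)) is at most C1 2^(-k (sigma + 1)), hence at
     most C1 / 2^k. *)
  have m_lim k : (P A <= m (2 ^+ k * a)%R + (2 * C1 / 2 ^+ k)%:E)%E.
    have tk_gt0 : (0:R) < 2 ^+ k by rewrite exprn_gt0.
    have := step setT (2 ^+ k * a); rewrite setIT probability_setT mule1.
    move=> /(_ (mulr_gt0 tk_gt0 a_gt0) (ltW e_gt0)) PA.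
    apply: (le_trans (PA _ _)).
    - exact: (@measurableT _ (g_sigma_algebraType _)).
    - exact: (@measurableT _ Omega).
    apply: leeD => //.
    have -> : e / (2 ^+ k * a) `^ H = (2 ^+ k) `^ (- H).
      rewrite powRM ?(ltW tk_gt0) ?(ltW a_gt0)// aHE invfM mulrCA.
      by rewrite divff ?gt_eqF// mulr1 powRN.
    rewrite -mulrA EFinM lee_pmul2l//.
    apply: le_trans (phi_le _ _) _; first by rewrite powR_gt0.
    rewrite lee_fin ler_pM2l// -powRrM mulNr mulrCA divff ?gt_eqF// mulr1.
    rewrite powRN lef_pV2 ?posrE ?powR_gt0// -[leLHS]powRr1 ?(ltW tk_gt0)//.
    by rewrite ler_powR ?exprn_ege1 ?ler1n// lerDr ltW.
  have as_gt0 : 0 < a `^ sigma by rewrite powR_gt0.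
  (* The level [k] depends on [e], but [M] does not depend on [k]. *)
  have [k k_large] : exists k : nat, 2 * C1 / 2 ^+ k <= a `^ sigma.
    exists (Num.truncn ((a `^ sigma)^-1 * (2 * C1))).+1.
    rewrite ler_pdivrMr ?exprn_gt0// -ler_pdivrMl// ltW//.
    apply: (lt_trans (truncnS_gt _)).
    by rewrite -natrX ltr_nat ltn_expl.
  rewrite small_ballE; apply: le_trans (m_lim k) _.
  apply: le_trans (leeD (m_bnd k) (lexx _)) _.
  rewrite -EFinD lee_fin -aE /M [leRHS]mulrDl mul1r; apply: lerD => //.
  rewrite ler_pM2r// lerD2l ler_pM2l ?mulr_gt0 ?powR_gt0// gerDl oppr_le0.
  by rewrite divr_ge0// exprn_ge0.
exists (f * f * cE * x0 `^ (- (sigma / H))), M, (x0 * eE `^ H); split.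
- by rewrite !mulr_gt0// powR_gt0.
- by rewrite mulr_gt0// powR_gt0.
- by move=> e /andP[e_gt0 e_lt]; rewrite lower//= upper.
Qed.
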